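(* Let $(N,\mu,\nu)$ be an intuitionistic fuzzy normed space, let $(u_k)_{k\ge 1}$ be a sequence in $N$ and let $a\in N$. If $(u_k)$ is statistically logarithmic summable to $a$ and slowly oscillating with respect to logarithmic summability, then $(u_k)$ is convergent to $a$ in $(N,\mu,\nu)$.
   Context: An intuitionistic fuzzy normed space (IFNS) is a triple $(N,\mu,\nu)$ where $N$ is a real vector space with zero vector $\theta$ and $\mu,\nu:N\times\mathbb{R}\to[0,1]$ satisfy, for all $u,w\in N$ and $t,s\in\mathbb{R}$: (a) $\mu(u,t)=0$ for $t\le 0$; (b) $\mu(u,t)=1$ for all $t>0$ if and only if $u=\theta$; (c) $\mu(cu,t)=\mu(u,t/|c|)$ for all $t>0$ and real $c\ne 0$; (d) $\mu(u+w,t+s)\ge\min\{\mu(u,t),\mu(w,s)\}$; (e) $\lim_{t\to\infty}\mu(u,t)=1$, and $\lim_{t\to 0}\mu(u,t)=0$ if $u\neq\theta$; (f) $\nu(u,t)=1$ for $t\le 0$; (g) $\nu(u,t)=0$ for all $t>0$ if and only if $u=\theta$; (h) $\nu(cu,t)=\nu(u,t/|c|)$ for all $t>0$ and real $c\neq 0$; (i) $\max\{\nu(u,t),\nu(w,s)\}\ge\nu(u+w,t+s)$; (j) $\lim_{t\to\infty}\nu(u,t)=0$, and $\lim_{t\to0}\nu(u,t)=1$ if $u\ne\theta$. A sequence $(u_k)$ in $N$ is convergent to $a\in N$ if for every $\varepsilon>0$ and $t>0$ there is $k_0\in\mathbb{N}$ such that $\mu(u_k-a,t)>1-\varepsilon$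 and $\nu(u_k-a,t)<\varepsilon$ for all $k\ge k_0$. A sequence $(v_k)$ in $N$ is statistically convergent to $a\in N$ with respect to $(\mu,\nu)$ if for every $\varepsilon>0$ and $t>0$, $\lim_{n\to\infty}\frac1n\left|\{k\le n:\mu(v_k-a,t)\le 1-\varepsilon\text{ or }\nu(v_k-a,t)\ge\varepsilon\}\right|=0$. $(u_k)$ is statistically logarithmic summable to $a$ if the sequence $(\tau_k)$ of logarithmic means $\tau_k=\frac{1}{\ell_k}\sum_{j=1}^k\frac{u_j}{j}$, where $\ell_k=\sum_{j=1}^k\frac1j$, is statistically convergent to $a$. $(u_k)$ is slowly oscillating with respect to logarithmic summability if for all $t>0$ and all $\varepsilon\in(0,1)$ there exist $\lambda>1$ and $m_0\in\mathbb{N}$ (depending on $t$ and $\varepsilon$) such that $\mu(u_k-u_n,t)>1-\varepsilon$ and $\nu(u_k-u_n,t)<\varepsilon$ whenever $m_0\le n<k\le\lfloor n^{\lambda}\rfloor$. *)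

(* Defs.v *)
From HB Require Import structures.
From mathcomp Require Import all_boot all_order all_algebra.
From mathcomp Require Import all_classical all_reals all_analysis.

Set Implicit Arguments.
Unset Strict Implicit.
Unset Printing Implicit Defensive.

Import Order.TTheory GRing.Theory Num.Theory.
Import numFieldNormedType.Exports.
Local Open Scope classical_set_scope.
Local Open Scope ring_scope.

Record is_ifns (R : realType) (N : lmodType R) (mu nu : N -> R -> R) : Prop := {
  ifns_mu_range : forall (u : N) (t : R), 0 <= mu u t <= 1;
  ifns_nu_range : forall (u : N) (t : R), 0 <= nu u t <= 1;
  ifns_mu_le0 : forall (u : N) (t : R), t <= 0 -> mu u t = 0;
  ifns_mu_eq1 : forall u : N, (forall t : R, 0 < t -> mu u t = 1) <-> u = 0;
  ifns_mu_scale : forall (u : N) (c t : R), 0 < t -> c != 0 ->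
    mu (c *: u) t = mu u (t / `|c|);
  ifns_mu_add : forall (u w : N) (t s : R),
    Num.min (mu u t) (mu w s) <= mu (u + w) (t + s);
  ifns_mu_cvg_pinfty : forall u : N, mu u t @[t --> +oo] --> (1 : R);
  ifns_mu_cvg_0 : forall u : N, u != 0 -> mu u t @[t --> 0^'] --> (0 : R);
  ifns_nu_le0 : forall (u : N) (t : R), t <= 0 -> nu u t = 1;
  ifns_nu_eq0 : forall u : N, (forall t : R, 0 < t -> nu u t = 0) <-> u = 0;
  ifns_nu_scale : forall (u : N) (c t : R), 0 < t -> c != 0 ->
    nu (c *: u) t = nu u (t / `|c|);
  ifns_nu_add : forall (u w : N) (t s : R),
    nu (u + w) (t + s) <= Num.max (nu u t) (nu w s);
  ifns_nu_cvg_pinfty : forall u : N, nu u t @[t --> +oo] --> (0 : R);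
  ifns_nu_cvg_0 : forall u : N, u != 0 -> nu u t @[t --> 0^'] --> (1 : R)
}.

(* Sequences indexed by k >= 1 are functions on nat whose value at 0 is never
   relevant: sums and counts below start at 1, and the remaining conditions
   only concern large indices. *)

Definition ifn_cvg (R : realType) (N : lmodType R) (mu nu : N -> R -> R)
    (u : nat -> N) (a : N) : Prop :=
  forall eps t : R, 0 < eps -> 0 < t ->
    exists k0 : nat, forall k : nat, (k0 <= k)%N ->
      1 - eps < mu (u k - a) t /\ nu (u k - a) t < eps.

Definition ifn_stat_cvg (R : realType) (N : lmodType R) (mu nu : N -> R -> R)
    (v : nat -> N) (a : N) : Prop :=
  forall eps t : R, 0 < eps -> 0 < t ->
    (count (fun k => (mu (v k - a) t <= 1 - eps) || (eps <= nu (v k - a) t))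
           (index_iota 1 n.+1))%:R / n%:R @[n --> \oo] --> (0 : R).

Definition log_weight (R : realType) (k : nat) : R :=
  \sum_(1 <= j < k.+1) j%:R^-1.

Definition log_mean (R : realType) (N : lmodType R) (u : nat -> N) (k : nat) : N :=
  (log_weight R k)^-1 *: \sum_(1 <= j < k.+1) (j%:R^-1 *: u j).

Definition ifn_stat_log_summable (R : realType) (N : lmodType R)
    (mu nu : N -> R -> R) (u : nat -> N) (a : N) : Prop :=
  ifn_stat_cvg mu nu (log_mean u) a.

Definition ifn_log_slowly_oscillating (R : realType) (N : lmodType R)
    (mu nu : N -> R -> R) (u : nat -> N) : Prop :=
  forall t eps : R, 0 < t -> 0 < eps < 1 ->
    exists (lambda : R) (m0 : nat), 1 < lambda /\
      forall n k : nat, (m0 <= n)%N -> (n < k)%N ->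
        k%:Z <= Num.floor (n%:R `^ lambda) ->
        1 - eps < mu (u k - u n) t /\ nu (u k - u n) t < eps.

(* Main.v *)
(* For a fixed eps, min/max additivity makes the sets
   [B_t = {w | mu w t > 1 - eps, nu w t < eps}] behave like the balls of a
   seminorm: [B_t + B_s] lies in [B_(t+s)] and [c B_t = B_(|c|t)].  A density-zero
   exceptional set misses some index of every [[n, 2n]] with n large, so for large k
   there are m near [k^alpha], with [1/lambda < alpha < 1], and M near k such that
   m < k <= M <= m^lambda and both logarithmic means tau_m, tau_M are close to a.
   The weighted mean of u over (m, M] is
   [(l_M tau_M - l_m tau_m) / (l_M - l_m)], which is close to a because
   [l_M / (l_M - l_m)] is bounded by about [1 / (1 - alpha)], and close to u_k by slow
   oscillation. *)
Require Import Defs.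
From HB Require Import structures.
From mathcomp Require Import all_boot all_order all_algebra.
From mathcomp Require Import all_classical all_reals all_analysis.
From mathcomp Require Import zify ring lra.

Set Implicit Arguments.
Unset Strict Implicit.
Unset Printing Implicit Defensive.

Import Order.TTheory GRing.Theory Num.Theory.
Import numFieldNormedType.Exports.
Local Open Scope classical_set_scope.
Local Open Scope ring_scope.

(** * Balls of the intuitionistic fuzzy norm *)

Definition ifn_ball (R : realType) (N : lmodType R) (mu nu : N -> R -> R)
    (eps t : R) (w : N) : Prop :=
  1 - eps < mu w t /\ nu w t < eps.

Section Ball.
Context (R : realType) (N : lmodType R) (mu nu : N -> R -> R).
Hypothesis ifnsN : is_ifns mu nu.

Lemma ifn_ball0 (eps t : R) : 0 < eps -> 0 < t -> ifn_ball mu nu eps t 0.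
Proof.
move=> e0 t0; split.
  by rewrite ((ifns_mu_eq1 ifnsN 0).2 erefl t t0) ltrBlDr ltrDl.
by rewrite ((ifns_nu_eq0 ifnsN 0).2 erefl t t0).
Qed.

Lemma ifn_ballD (eps t s : R) (v w : N) :
  ifn_ball mu nu eps t v -> ifn_ball mu nu eps s w ->
  ifn_ball mu nu eps (t + s) (v + w).
Proof.
move=> [muv nuv] [muw nuw]; split.
  by apply: lt_le_trans (ifns_mu_add ifnsN v w t s); rewrite lt_min muv.
by apply: le_lt_trans (ifns_nu_add ifnsN v w t s) _; rewrite gt_max nuv.
Qed.

Lemma ifn_ballZ (eps t c : R) (w : N) : 0 < t -> c != 0 ->
  ifn_ball mu nu eps t w -> ifn_ball mu nu eps (`|c| * t) (c *: w).
Proof.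
move=> t0 c0 [muw nuw]; have ct0 : 0 < `|c| * t by rewrite mulr_gt0 ?normr_gt0.
have ctc : `|c| * t / `|c| = t by rewrite mulrAC divff ?mul1r ?normr_eq0.
by split; rewrite ?(ifns_mu_scale ifnsN) ?(ifns_nu_scale ifnsN) ?ctc.
Qed.

Lemma ifn_ballN (eps t : R) (w : N) : 0 < t ->
  ifn_ball mu nu eps t w -> ifn_ball mu nu eps t (- w).
Proof.
move=> t0; have := @ifn_ballZ eps t (-1) w t0.
by rewrite normrN1 mul1r scaleN1r oppr_eq0 oner_eq0; apply.
Qed.

(** Monotonicity in the radius comes from additivity: [w = w + 0], with [0] in the ball of radius
    [s - t]. *)
Lemma ifn_ball_le (eps t s : R) (w : N) : 0 < eps -> t <= s ->
  ifn_ball mu nu eps t w -> ifn_ball mu nu eps s w.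
Proof.
rewrite le_eqVlt => e0 /predU1P[-> //|ts] Bw.
rewrite -(subrK t s) addrC -(addr0 w); apply: ifn_ballD => //.
by apply: ifn_ball0; rewrite ?subr_gt0.
Qed.

(** The induction starts at a single term: an empty sum would have radius 0, where [mu] vanishes. *)
Lemma ifn_ball_sum (eps t : R) (c : nat -> R) (w : nat -> N) (m n : nat) :
  0 < t -> (m < n)%N ->
  (forall j, (m <= j < n)%N -> 0 < c j /\ ifn_ball mu nu eps t (w j)) ->
  ifn_ball mu nu eps ((\sum_(m <= j < n) c j) * t) (\sum_(m <= j < n) c j *: w j).
Proof.
move=> t0; elim: n => // n IHn; rewrite ltnS leq_eqVlt => mn H.
have cB : ifn_ball mu nu eps (c n * t) (c n *: w n).
  have [|cn0 Bn] := H n; first by case/predU1P: mn => [->|/ltnW ->] /=; rewrite ?leqnn.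
  by rewrite -{1}(gtr0_norm cn0); apply: ifn_ballZ; rewrite ?gt_eqF.
case/predU1P: mn => [<-{IHn H}|mn] in cB *; first by rewrite !big_nat1.
rewrite !big_nat_recr ?(ltnW mn) //= mulrDl; apply: ifn_ballD => //.
by apply: IHn => // j /andP[mj jn]; apply: H; rewrite mj ltnW.
Qed.

(** For large [n], fewer than half of the indices up to [2n] are bad, that is, fewer than [n]; the
    [n + 1] indices of [[n, 2n]] cannot all be bad. *)
Lemma ifn_stat_cvg_ball (v : nat -> N) (a : N) (eps t : R) :
  0 < eps -> 0 < t -> ifn_stat_cvg mu nu v a ->
  exists n0, forall n, (n0 <= n)%N ->
    exists2 m, (n <= m <= n.*2)%N & ifn_ball mu nu eps t (v m - a).
Proof.
move=> e0 t0 /(_ eps t e0 t0) /cvgr_lt /(_ (2^-1)).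
rewrite invr_gt0 ltr0n => /(_ isT) [n0 _ Hn0].
exists n0.+1 => n n0n; have n_gt0 : (0 < n)%N by apply: leq_trans n0n.
set bad := fun k => _ || _ in Hn0.
have /negP : ~~ all bad (index_iota n n.*2.+1).
  have /Hn0 /= : (n0 <= n.*2)%N by lia.
  rewrite ltr_pdivrMr ?ltr0n ?double_gt0 // -muln2 natrM mulrCA mulVf ?mulr1 //.
  rewrite ltr_nat muln2 => lt_n; rewrite all_count.
  rewrite size_iota neq_ltn; apply/orP; left.
  have -> : (n.*2.+1 - n)%N = n.+1 by lia.
  rewrite ltnS; apply/ltnW; apply: leq_ltn_trans lt_n.
  have -> : index_iota 1 n.*2.+1 = index_iota 1 n ++ index_iota n n.*2.+1.
    rewrite /index_iota; have -> : (n.*2.+1 - 1 = (n - 1) + (n.*2.+1 - n))%N by lia.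
    by rewrite iotaD subnKC.
  by rewrite count_cat leq_addl.
move=> nall; apply: contrapT => noex; apply: nall; apply/allP => m.
rewrite mem_index_iota ltnS => mn; apply: contrapT => /negP.
rewrite /bad negb_or -ltNge -ltNge => /andP[mum num].
by apply: noex; exists m.
Qed.

End Ball.

(** * Logarithmic bounds on the weights *)

(** Telescopes [ln (j + 1) - ln j = ln (1 + 1/j) <= 1/j] over [m < j <= n]. *)
Lemma log_weightB_ge (R : realType) (m n : nat) : (m <= n)%N ->
  ln n.+1%:R - ln m.+1%:R <= log_weight R n - log_weight R m.
Proof.
move=> mn; rewrite /log_weight [X in _ <= X - _](@big_cat_nat _ _ _ m.+1) //=.
rewrite addrAC subrr add0r -(@telescope_sumr _ _ _ (fun j => ln j%:R)) //.
apply: ler_sum_nat => j /andP[mj _]; have j0 : (0 < j)%N by apply: leq_trans mj.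
have jR : 0 < j%:R :> R by rewrite ltr0n.
rewrite -ln_div ?posrE ?ltr0n // -natr1 mulrDl divff ?gt_eqF // mul1r.
by apply: le_ln1Dx; apply: (@lt_trans _ _ 0); rewrite ?invr_gt0 // ltrN10.
Qed.

(** Telescopes [1/(j + 1) <= - ln (1 - 1/(j + 1)) = ln (j + 1) - ln j] after splitting off the term
    1. *)
Lemma log_weight_le (R : realType) (n : nat) : (0 < n)%N ->
  log_weight R n <= 1 + ln n%:R.
Proof.
case: n => // n _; rewrite /log_weight big_nat_recl //= invr1 lerD2l.
have -> : ln n.+1%:R = \sum_(1 <= j < n.+1) (ln j.+1%:R - ln j%:R) :> R.
  by rewrite telescope_sumr // ln1 subr0.
rewrite (_ : \sum_(1 <= i < n.+1) _ = \sum_(1 <= j < n.+1) j.+1%:R^-1) //.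
apply: ler_sum_nat => j /andP[j0 _].
have jR : 0 < j%:R :> R by rewrite ltr0n.
have sR : 0 < j.+1%:R :> R by rewrite ltr0n.
rewrite -lerN2 opprB -ln_div ?posrE //.
have -> : j%:R / j.+1%:R = 1 + - j.+1%:R^-1 :> R.
  by rewrite -natr1; field; rewrite natr1 gt_eqF.
apply: le_ln1Dx; rewrite ltrN2 invf_lt1 // ltr1n ltnS //.
Qed.

(** [K] depends on [lambda] alone, so that a radius can be chosen from it before the threshold [p0].
    The witness [p] is the integer part of [k^alpha]; letting [m] and [M] range over [[p, 2p]] and
    [[k, 2k]] costs only bounded errors in the logarithms. *)
Lemma log_window (R : realType) (lambda : R) : 1 < lambda ->
  exists2 K : R, 0 < K & forall p0 : nat, exists k0 : nat, forall k, (k0 <= k)%N ->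
    exists2 p, (p0 <= p)%N & forall m M, (p <= m <= p.*2)%N -> (k <= M <= k.*2)%N ->
      [/\ (m < k)%N, M%:Z <= Num.floor (m%:R `^ lambda),
          0 < log_weight R M - log_weight R m &
          log_weight R M <= K * (log_weight R M - log_weight R m)].
Proof.
(* The midpoint of [1/lambda] and 1, so [lambda * alpha > 1] and [alpha > 1/2]. *)
move=> l1; pose alpha := (1 + lambda^-1) / 2.
have l0 : 0 < lambda by lra.
have lV : lambda * lambda^-1 = 1 by rewrite divff ?gt_eqF.
have lV0 : 0 < lambda^-1 by rewrite invr_gt0.
have lV1 : lambda^-1 < 1 by rewrite invf_lt1.
have al : 2 * (lambda * alpha) = lambda + 1 by rewrite /alpha; field; rewrite gt_eqF.
have a12 : 1 < 2 * alpha by rewrite /alpha; lra.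
have b0 : 0 < 1 - alpha by rewrite /alpha; lra.
have g0 : 0 < lambda * alpha - 1 by lra.
(* With [L = ln k], this is the ratio of the bound [l_M <= L + 2 <= 2 L] to the bound
   [l_M - l_m >= (1 - alpha) L / 2]. *)
exists (4 / (1 - alpha)); first by rewrite divr_gt0.
move=> p0.
(* [A] is chosen so that the four bounds [HL1]-[HL4] below hold as soon as [A <= ln k]. *)
pose L1 := (lambda + 1) / (lambda * alpha - 1).
pose L2 := 4 / (1 - alpha).
pose A := L1 + L2 + 2 + 2 * p0.+1%:R.
have L10 : 0 < L1 by rewrite divr_gt0 //; lra.
have L20 : 0 < L2 by rewrite divr_gt0.
exists (Num.truncn (expR A)).+1 => k kA.
have k0 : (0 < k)%N by apply: leq_trans kA.
have kR : 0 < k%:R :> R by rewrite ltr0n.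
pose L := ln k%:R : R.
have AL : A <= L.
  rewrite -[A]expRK ler_ln ?posrE ?expR_gt0 //.
  by apply: ltW; apply: lt_le_trans (truncnS_gt _) _; rewrite ler_nat.
have p00 : 0 <= p0.+1%:R :> R by [].
have HL1 : lambda + 1 <= (lambda * alpha - 1) * L.
  by rewrite mulrC -ler_pdivrMr // -/L1; rewrite /A in AL; lra.
have HL2 : 4 <= (1 - alpha) * L.
  by rewrite mulrC -ler_pdivrMr // -/L2; rewrite /A in AL; lra.
have HL3 : 2 <= L by rewrite /A in AL; lra.
have HL4 : p0.+1%:R <= alpha * L.
  have : 2 * p0.+1%:R <= L by rewrite /A in AL; lra.
  have : L <= 2 * alpha * L by rewrite ler_peMl; lra.
  lra.
pose E := expR (alpha * L); have E0 : 0 < E by apply: expR_gt0.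
pose p := Num.truncn E.
have p0p : (p0 < p)%N.
  rewrite truncn_gt_nat; apply: le_trans (expR_ge1Dx _); lra.
have /andP[pE Ep] : p%:R <= E < p.+1%:R by apply: truncn_itv; apply: ltW.
have ln2 : ln 2 <= 1 :> R.
  by have := @le_ln1Dx R 1; rewrite -[1 + 1]/(2%:R); apply; lra.
have lnE : ln E = alpha * L by rewrite expRK.
have lnk : ln k%:R = L by [].
exists p; first exact: ltnW.
clearbody p E; clearbody L; clear kA AL HL4; clearbody alpha.
move=> m M /andP[pm mp] /andP[kM Mk].
have [m0 M0 pSm Smp M2k] : [/\ (0 < m)%N, (0 < M)%N, (p.+1 <= 2 * m)%N,
    (m.+1 <= 2 * (2 * p))%N & (M <= 2 * k)%N].
  by move: p0p pm mp kM Mk k0; clear; split; lia.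
have mR : 0 < m%:R :> R by rewrite ltr0n.
have MR : 0 < M%:R :> R by rewrite ltr0n.
have lnm : alpha * L - 1 <= ln m%:R.
  have : ln E <= ln (2 * m%:R) :> R.
    rewrite ler_ln ?posrE ?mulr_gt0 //; apply/ltW/(lt_le_trans Ep).
    by rewrite -natrM ler_nat.
  by rewrite lnE lnM ?posrE //; lra.
have lnSm : ln m.+1%:R <= alpha * L + 2.
  have : ln m.+1%:R <= ln (2 * (2 * E)) :> R.
    rewrite ler_ln ?posrE ?ltr0n ?mulr_gt0 //.
    have : m.+1%:R <= (2 * (2 * p))%:R :> R by rewrite ler_nat.
    rewrite !natrM; lra.
  by rewrite !lnM ?posrE ?mulr_gt0 // lnE; lra.
have lnM1 : ln M%:R <= L + 1.
  have : ln M%:R <= ln (2 * k%:R) :> R.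
    by rewrite ler_ln ?posrE ?mulr_gt0 // -natrM ler_nat.
  by rewrite lnM ?posrE // lnk; lra.
have mk : (m < k)%N.
  apply: ltnW; rewrite -(ltr_nat R) -ltr_ln ?posrE ?ltr0n // lnk; lra.
have lwB : (1 - alpha) * L / 2 <= log_weight R M - log_weight R m.
  have mM : (m <= M)%N := leq_trans (ltnW mk) kM.
  apply: le_trans (log_weightB_ge R mM).
  have : L <= ln M.+1%:R by rewrite -lnk ler_ln ?posrE ?ltr0n // ler_nat ltnW.
  lra.
split=> //.
(* [HL1] says [L + 1 <= lambda * (alpha * L - 1)], whence [ln M <= lambda * ln m]. *)
- rewrite floor_ge_int -pmulrn /powR gt_eqF // -[X in X <= _]lnK ?posrE //.
  rewrite ler_expR; apply: le_trans lnM1 _.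
  have : lambda * (alpha * L - 1) <= lambda * ln m%:R by rewrite ler_pM2l.
  lra.
- by apply: lt_le_trans lwB; lra.
- apply: le_trans (log_weight_le R M0) _.
  rewrite mulrAC ler_pdivlMr //.
  have : (1 + ln M%:R) * (1 - alpha) <= (2 * L) * (1 - alpha).
    by rewrite ler_pM2r //; lra.
  lra.
Qed.

(** * Logarithmic means over a window *)

Lemma log_weight_gt0 (R : realType) (n : nat) : (0 < n)%N -> 0 < log_weight R n.
Proof.
move=> n0; have := log_weightB_ge R (leq0n n).
rewrite ln1 subr0 [log_weight R 0]/log_weight big_nil subr0; apply: lt_le_trans.
by rewrite ln_gt0 // ltr1n.
Qed.

Lemma log_mean_sub (R : realType) (N : lmodType R) (u : nat -> N) (a : N) (n : nat) :
  (0 < n)%N ->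
  log_weight R n *: (log_mean u n - a) =
  \sum_(1 <= j < n.+1) j%:R^-1 *: (u j - a).
Proof.
move=> n0; have ln0 := lt0r_neq0 (log_weight_gt0 R n0).
rewrite scalerBr /log_mean scalerA divff // scale1r.
under [RHS]eq_bigr do rewrite scalerBr.
by rewrite sumrB -scaler_suml.
Qed.

(** The last bracket is the sum of [(u j - a) / j] over [m < j <= n], and
    [x - a = (x - u j) + (u j - a)] termwise. *)
Lemma log_window_mean (R : realType) (N : lmodType R) (u : nat -> N) (a x : N)
    (m n : nat) : (0 < m)%N -> (m < n)%N ->
  (log_weight R n - log_weight R m) *: (x - a) =
  \sum_(m.+1 <= j < n.+1) j%:R^-1 *: (x - u j) +
  (log_weight R n *: (log_mean u n - a) - log_weight R m *: (log_mean u m - a)).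
Proof.
move=> m0 mn; have n0 := ltn_trans m0 mn; rewrite !log_mean_sub //.
have catB (V : zmodType) (f : nat -> V) :
    \sum_(1 <= j < n.+1) f j - \sum_(1 <= j < m.+1) f j = \sum_(m.+1 <= j < n.+1) f j.
  by rewrite [X in X - _](@big_cat_nat _ _ _ m.+1) ?ltnS ?(ltnW mn) //= addrAC subrr add0r.
rewrite !catB scaler_suml -big_split /=; apply: eq_bigr => j _.
by rewrite -scalerDr addrA subrK.
Qed.

(** * The Tauberian argument *)

Theorem theorem3p6 (R : realType) (N : lmodType R) (mu nu : N -> R -> R)
    (ifnsN : is_ifns mu nu) (u : nat -> N) (a : N)
    (sum_u : ifn_stat_log_summable mu nu u a)
    (osc_u : ifn_log_slowly_oscillating mu nu u) :
  ifn_cvg mu nu u a.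
Proof.
move=> eps0 t eps0_gt0 t0.
(* Slow oscillation is available only for [eps < 1]; a smaller [eps] gives smaller balls. *)
pose eps : R := Num.min eps0 2^-1.
have e0 : 0 < eps by rewrite lt_min eps0_gt0 invr_gt0 ltr0n.
have e1 : eps < 1 by rewrite gt_min; apply/orP; right; rewrite invf_lt1 // ltr1n.
suff [k0 Hk0] : exists k0, forall k, (k0 <= k)%N -> ifn_ball mu nu eps t (u k - a).
  exists k0 => k /Hk0[muk nuk]; have ee : eps <= eps0 by rewrite ge_min lexx.
  by split; [apply: le_lt_trans muk; rewrite lerD2l lerN2|apply: lt_le_trans ee].
have t20 : 0 < t / 2 by rewrite divr_gt0.
have [|lambda [m0 [l1 osc]]] := osc_u (t / 2) eps t20; first by rewrite e0.
have [K K0 window] := log_window l1.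
(* Since [l_m <= l_M <= K * D], the two means will contribute at most
   [2 * K * D * s = D * t / 2]. *)
pose s := t / (4 * K); have s0 : 0 < s by rewrite divr_gt0 ?mulr_gt0.
have [n0 good] := ifn_stat_cvg_ball e0 s0 sum_u.
have [k1 Hk1] := window (m0 + n0).+1.
exists (k1 + n0)%N => k kk.
have [|p p0 Hp] := Hk1 k; first by lia.
have [|m mp Bm] := good p; first by lia.
have [|M Mk BM] := good k; first by lia.
have [mk Ml] := Hp m M mp Mk.
set D := _ - _ => D0 KD.
have /andP[pm _] := mp; have /andP[kM _] := Mk.
have mM : (m < M)%N := leq_trans mk kM.
have m0m : (m0 + n0 < m)%N := leq_trans p0 pm.
have m_gt0 : (0 < m)%N := leq_ltn_trans (leq0n _) m0m.
have M_gt0 : (0 < M)%N := ltn_trans m_gt0 mM.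
have lm0 := log_weight_gt0 R m_gt0; have lM0 := log_weight_gt0 R M_gt0.
(* Any two indices of the window are comparable, as [j <= M <= m^lambda <= i^lambda]; this covers
   terms on both sides of [k]. *)
have close i j : (m < i)%N -> (i <= j)%N -> (j <= M)%N ->
    ifn_ball mu nu eps (t / 2) (u j - u i).
  move=> mi; rewrite leq_eqVlt => /predU1P[<- _|ij jM].
    by rewrite subrr; apply: ifn_ball0.
  apply: osc => //; first exact: ltnW (ltn_trans (leq_ltn_trans (leq_addr n0 m0) m0m) mi).
  rewrite floor_ge_int -pmulrn; move: Ml; rewrite floor_ge_int -pmulrn => Ml.
  have : m%:R `^ lambda <= i%:R `^ lambda.
    by rewrite ge0_ler_powR ?nnegrE ?ler_nat ?(ltnW mi) //; lra.
  by apply: le_trans; apply: le_trans Ml; rewrite ler_nat.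
have BS : ifn_ball mu nu eps (D * (t / 2))
    (\sum_(m.+1 <= j < M.+1) j%:R^-1 *: (u k - u j)).
  have -> : D = \sum_(m.+1 <= j < M.+1) j%:R^-1.
    rewrite /D /log_weight [X in X - _](@big_cat_nat _ _ _ m.+1) //=.
      by rewrite addrAC subrr add0r.
    by rewrite ltnS ltnW.
  apply: ifn_ball_sum => // j /andP[mj jM]; split.
    by rewrite invr_gt0 ltr0n (leq_ltn_trans _ mj).
  have [jk|/ltnW kj] := leqP j k; first exact: close.
  by rewrite -opprB; apply: ifn_ballN => //; apply: close.
have BD : ifn_ball mu nu eps (D * (t / 2) + (log_weight R M * s + log_weight R m * s))
    (D *: (u k - a)).
  rewrite (@log_window_mean _ _ u) //; apply: ifn_ballD => //.
  apply: ifn_ballD => //.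
    by rewrite -{1}(gtr0_norm lM0); apply: ifn_ballZ; rewrite ?gt_eqF.
  apply: ifn_ballN => //; first by rewrite mulr_gt0.
  by rewrite -{1}(gtr0_norm lm0); apply: ifn_ballZ; rewrite ?gt_eqF.
have DV0 : 0 < D^-1 by rewrite invr_gt0.
have -> : u k - a = D^-1 *: (D *: (u k - a)) by rewrite scalerA mulVf ?scale1r ?gt_eqF.
(* After division by [D], oscillation accounts for [t / 2] and the means for at most [t / 2]. *)
apply: ifn_ball_le e0 _ (ifn_ballZ ifnsN _ _ BD); rewrite ?gt_eqF //.
  rewrite gtr0_norm // mulrC ler_pdivrMr //.
  have -> : t = s * (4 * K) by rewrite /s mulfVK ?gt_eqF ?mulr_gt0.
  have : log_weight R M * s <= K * D * s by rewrite ler_pM2r.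
  have : log_weight R m * s <= log_weight R M * s by rewrite ler_pM2r // -subr_ge0 ltW.
  lra.
by do !apply: addr_gt0; apply: mulr_gt0.
Qed.
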